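(* Let $\mathcal X=\{x\in\mathbb R^n: H_{\mathcal X}x\le h_{\mathcal X}\}$ be a nonempty polyhedral set with $H_{\mathcal X}\in\mathbb R^{m_{\mathcal X}\times n}$, $h_{\mathcal X}\in\mathbb R^{m_{\mathcal X}}$, let $\mathcal W\subseteq\mathbb R^n$ be nonempty and bounded, let $\mathscr A_{\rm v}=\{\overline A_1,\dots,\overline A_s\}\subseteq\mathbb R^{n\times n}$ be a finite family of matrices, and suppose that either $\mathscr A=\mathscr A_{\rm v}$ (finite case) or $\mathscr A=\operatorname{conv}(\mathscr A_{\rm v})$ (polytopic case). Let $\{\mathcal X_k\}_{k\in\mathbb N}$, $\{\overline{\mathcal X}_k\}_{k\ge1}$, $\{\mathcal Y_k\}_{k\in\mathbb N}$ be the sequences defined in the context, with $\mathcal X_0=\mathcal Y_0=\mathcal X$. Then: (i) the sets $\mathcal X_k$ and $\mathcal Y_k$ are polyhedral for every $k\in\mathbb N$. Consequently, if the maximal robust positively invariant set $\mathcal M$ is finitely determined (i.e. $\mathcal M=\mathcal X_k$ for some $k\in\mathbb N$), then $\mathcal M$ is polyhedral; (ii) in the polytopic case $\mathscr A=\operatorname{conv}(\mathscr A_{\rm v})$, for every $k\in\mathbb N$, $$\overline{\mathcal X}_{k+1}=\bigcap_{A\in\mathscr A}A^{-1}(\mathcal X_k\ominus\mathcal W)=\bigcap_{i=1}^{s}\overline A_i^{-1}(\mathcal X_k\ominus\mathcal W),$$ and, for every $k\ge1$, $$\mathcal Y_k=\bigcap_{\boldsymbol\Psi_k\in\mathfrak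 B_k(\mathscr A)}\Psi_{k,0}^{-1}\Big(\mathcal X\ominus\sum_{i=0}^{k-1}\Psi_{k,i+1}\mathcal W\Big)=\bigcap_{\boldsymbol\Psi_k\in\mathfrak B_k(\mathscr A_{\rm v})}\Psi_{k,0}^{-1}\Big(\mathcal X\ominus\sum_{i=0}^{k-1}\Psi_{k,i+1}\mathcal W\Big).$$
   Context: $\mathbb N$ denotes the nonnegative integers. A polyhedral set is an intersection of finitely many closed half-spaces. Put $\mathcal F(x):=\{Ax+w: A\in\mathscr A,\ w\in\mathcal W\}$. A set $\mathcal S\subseteq\mathbb R^n$ is robust positively invariant if for all $x\in\mathcal S$ one has $\mathcal F(x)\subseteq\mathcal S$ and $x\in\mathcal X$; the maximal robust positively invariant set $\mathcal M$ is the (existing, unique) robust positively invariant set containing every other one. For sets $\mathcal S,\mathcal D\subseteq\mathbb R^n$ with $\mathcal D$ nonempty, $\mathcal S\ominus\mathcal D:=\{z\in\mathbb R^n: z+\mathcal D\subseteq\mathcal S\}$ (Pontryagin difference); for a matrix $M$, $M^{-1}\mathcal S:=\{x:Mx\in\mathcal S\}$ (preimage); sums of sets are Minkowski sums. For a matrix family $\mathscr B$ and $k\ge1$, $\mathfrak B_k(\mathscr B)$ is the set of tuples $\boldsymbol\Psi_k=(\Psi_{k,0},\dots,\Psi_{k,k})$ generated by $A_0,\dots,A_{k-1}\in\mathscr B$ via $\Psi_{k,k}:=I$ and $\Psi_{k,i}:=A_{k-1}A_{k-2}\cdots A_i$ for $0\le i\le k-1$. Set $\mathcal Y_0:=\mathcal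 X$ and, for $k\ge1$, $\mathcal Y_k:=\bigcap_{\boldsymbol\Psi_k\in\mathfrak B_k(\mathscr A)}\Psi_{k,0}^{-1}\big(\mathcal X\ominus\sum_{i=0}^{k-1}\Psi_{k,i+1}\mathcal W\big)$. The sequence $\{\mathcal X_k\}$ is given by $\mathcal X_0:=\mathcal X$ and any one of the following recursions (which generate the same sequence), where $\overline{\mathcal X}_{k+1}:=\bigcap_{A\in\mathscr A}A^{-1}(\mathcal X_k\ominus\mathcal W)$: standard, $\mathcal X_{k+1}=\overline{\mathcal X}_{k+1}\cap\mathcal X$; self-restricted, $\mathcal X_{k+1}=\overline{\mathcal X}_{k+1}\cap\mathcal X_k$; incremental, $\mathcal X_{k+1}=\mathcal X_k\cap\mathcal Y_{k+1}$. *)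

(* Defs.v *)
From HB Require Import structures.
From mathcomp Require Import all_boot all_order all_algebra.
From mathcomp Require Import all_classical all_reals all_analysis.
Set Implicit Arguments.
Unset Strict Implicit.
Unset Printing Implicit Defensive.
Import Order.TTheory GRing.Theory Num.Theory.
Import numFieldNormedType.Exports.
Local Open Scope classical_set_scope.
Local Open Scope ring_scope.

Section Polyhedra.
Variables (R : realType) (n : nat).

(* The normal vector is required to be nonzero, so that these are genuine
   half-spaces. *)
Definition closed_halfspace (S : set 'cV[R]_n) : Prop :=
  exists (a : 'rV[R]_n) (b : R), a != 0 /\ S = [set x | (a *m x) 0 0 <= b].

Definition polyhedral (S : set 'cV[R]_n) : Prop :=
  exists (m : nat) (P : 'I_m -> set 'cV[R]_n),
    (forall i, closed_halfspace (P i)) /\ S = \bigcap_i P i.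

End Polyhedra.

Section SetOperations.
Variables (R : realType) (V : lmodType R).

Definition convex_hull (S : set V) : set V := smallest (@convex_set R V) S.

Definition pontryagin_diff (S D : set V) : set V :=
  [set z | [set z + d | d in D] `<=` S].

Definition minkowski_sum (k : nat) (S : 'I_k -> set V) : set V :=
  [set \sum_(i < k) v i | v in [set v : 'I_k -> V | forall i, S i (v i)]].

End SetOperations.

Section Dynamics.
Variables (R : realType) (n : nat).
Implicit Types (F : set 'M[R]_n) (X W S : set 'cV[R]_n).

Definition successors F W (x : 'cV[R]_n) : set 'cV[R]_n :=
  [set A *m x + w | A in F & w in W].

Definition robust_positively_invariant F W X S : Prop :=
  forall x, S x -> successors F W x `<=` S /\ X x.

Definition maximal_rpi F W X (M : set 'cV[R]_n) : Prop :=
  robust_positively_invariant F W X M /\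
  forall S, robust_positively_invariant F W X S -> S `<=` M.

(* The factors are listed from index k - 1 down to i, which matters because
   the product is not commutative; for i = k the product is empty. *)
Definition transition (A : nat -> 'M[R]_n) (k i : nat) : 'M[R]_n :=
  \prod_(j <- rev (index_iota i k)) A j.

Definition transition_tuples F (k : nat) : set ('I_k.+1 -> 'M[R]_n) :=
  [set Psi | exists2 A : nat -> 'M[R]_n,
     forall j, (j < k)%N -> F (A j) &
     forall i : 'I_k.+1, Psi i = transition A k i].
Arguments transition_tuples F k : clear implicits.

(* For i : 'I_k, [lift ord0 i] is the index i + 1 in 'I_k.+1. *)
Definition Y_inter F X W (k : nat) : set 'cV[R]_n :=
  \bigcap_(Psi in transition_tuples F k)
    mulmx (Psi ord0) @^-1`
      pontryagin_diff X
        (minkowski_sum (fun i : 'I_k => mulmx (Psi (lift ord0 i)) @` W)).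

Definition Y_seq F X W (k : nat) : set 'cV[R]_n :=
  if k is 0%N then X else Y_inter F X W k.

Definition robust_pre F W S : set 'cV[R]_n :=
  \bigcap_(A in F) mulmx A @^-1` pontryagin_diff S W.

Inductive recursion := Standard | SelfRestricted | Incremental.

Fixpoint X_seq (r : recursion) F X W (k : nat) : set 'cV[R]_n :=
  if k is j.+1 then
    let Xj := X_seq r F X W j in
    match r with
    | Standard => robust_pre F W Xj `&` X
    | SelfRestricted => robust_pre F W Xj `&` Xj
    | Incremental => Xj `&` Y_seq F X W j.+1
    end
  else X.

(* The sequence with an overline starts at index 1:
   [Xbar_succ r F X W k] is its term of index k + 1. *)
Definition Xbar_succ (r : recursion) F X W (k : nat) : set 'cV[R]_n :=
  robust_pre F W (X_seq r F X W k).

End Dynamics.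

Arguments transition_tuples {R n} F k.

(* Main.v *)
Require Import Defs.
From HB Require Import structures.
From mathcomp Require Import all_boot all_order all_algebra.
From mathcomp Require Import all_classical all_reals all_analysis.
Set Implicit Arguments.
Unset Strict Implicit.
Unset Printing Implicit Defensive.
Import Order.TTheory GRing.Theory Num.Theory.
Import numFieldNormedType.Exports.
Local Open Scope classical_set_scope.
Local Open Scope ring_scope.

(** All the sequences are built from [X] by intersections and by one operator,
    [robust_pre F W S], the set of points whose successors all lie in [S].
    Everything follows from two properties of this operator.

    First, it preserves polyhedral sets when [F] is the range of a finite
    family ([polyhedral_robust_pre_range]).  For one matrix [A] and one
    half-space [a *m x <= b], requiring [a *m (A *m x + w) <= b] for all [w] in
    [W] amounts to [a *m A *m x <= b - sup (a *m w)]; the supremum is finite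
    because [W] is nonempty and bounded.  The new normal [a *m A] may be zero,
    and half-spaces have nonzero normals, so the inequality may have to be
    replaced by the whole space or by the empty set ([polyhedral_le]).

    Second, when [S] is convex, replacing [F] by its convex hull does not change
    [robust_pre F W S] ([robust_pre_convex_hull]): for fixed [x] and [w] the
    matrices that send [x] into [S] form a convex set.  Polyhedral sets are
    convex, so the polytopic case reduces to the finite one, and this reduction
    is also the vertex formula for the overlined sequence.

    The tuples of transition matrices disappear through the backward recursion
    [Y_seq F X W k.+1 = robust_pre F W (Y_seq F X W k)] ([Y_seqS]): a point is in
    [Y_seq F X W k] if and only if every trajectory of length [k] from it ends in [X],
    and a trajectory is a first step followed by a shifted trajectory.  Both
    claims about [Y_seq] are then inductions on [k] with the two properties
    above, without any multilinearity argument in [k] matrices. *)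

(** * Polyhedral sets *)

Lemma conv_lmodE (R : realType) (V : lmodType R) (t : {i01 R})
    (x y : convex_lmodType V) :
  conv t x y = t%:num *: (x : V) + (1 - t%:num) *: (y : V).
Proof. by []. Qed.

Section PolyhedralSets.
Variables (R : realType) (n : nat).
Implicit Types (S : set 'cV[R]_n) (a : 'rV[R]_n) (b : R).

Lemma polyhedralT : polyhedral [set: 'cV[R]_n].
Proof.
exists 0%N, (fun=> setT); split; first by case.
by apply/seteqP; split=> // x _ [].
Qed.

Lemma polyhedralI S1 S2 :
  polyhedral S1 -> polyhedral S2 -> polyhedral (S1 `&` S2).
Proof.
move=> [m1 [P1 [hP1 ->]]] [m2 [P2 [hP2 ->]]].
exists (m1 + m2)%N.
exists (fun i => match fintype.split i with inl j => P1 j | inr j => P2 j end).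
split; first by move=> i; case: (fintype.split i).
apply/seteqP; split=> [x [x1 x2] i _|x xP].
  by case: (fintype.split i) => j; [exact: x1|exact: x2].
split=> j _.
- by have := xP (unsplit (inl j)) I; rewrite unsplitK.
- by have := xP (unsplit (inr j)) I; rewrite unsplitK.
Qed.

Lemma polyhedral_bigcap m (S : 'I_m -> set 'cV[R]_n) :
  (forall i, polyhedral (S i)) -> polyhedral (\bigcap_i S i).
Proof.
move=> hS.
have -> : \bigcap_i S i = \big[setI/setT]_(i < m) S i.
  rewrite -(@bigcap_seq _ _ (index_enum _)).
  apply/seteqP; split=> x xS i _; apply: xS => //=.
  by rewrite mem_index_enum.
by apply: big_ind => [|? ?|//]; [exact: polyhedralT|exact: polyhedralI].
Qed.

Lemma closed_halfspace_polyhedral S : closed_halfspace S -> polyhedral S.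
Proof.
move=> hS; exists 1%N, (fun=> S); split=> //.
by apply/seteqP; split=> [x Sx ? //|x]; apply; exact: (I : setT (ord0 : 'I_1)).
Qed.

(** Two disjoint parallel half-spaces; in dimension 0 there is no half-space,
    so that [set0] is not polyhedral there. *)
Lemma polyhedral0 : (0 < n)%N -> polyhedral (set0 : set 'cV[R]_n).
Proof.
move=> n_gt0; pose a : 'rV[R]_n := delta_mx 0 (Ordinal n_gt0).
have a_neq0 : a != 0.
  apply/eqP => /matrixP/(_ 0 (Ordinal n_gt0)).
  by rewrite !mxE !eqxx => /eqP; rewrite oner_eq0.
have -> : set0 = [set x : 'cV[R]_n | (a *m x) 0 0 <= 0] `&`
                 [set x | (- a *m x) 0 0 <= - 1].
  apply/seteqP; split=> // x [/= ax0]; rewrite mulNmx mxE lerN2 => ax1.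
  by have := le_trans ax1 ax0; rewrite ler10.
apply: polyhedralI; apply: closed_halfspace_polyhedral.
- by exists a, 0.
- by exists (- a), (- 1); rewrite oppr_eq0.
Qed.

(** The row [a] may vanish, in which case the inequality is either trivial or
    infeasible; the hypothesis excludes infeasibility in dimension 0. *)
Lemma polyhedral_le a b :
  (0 < n)%N \/ [set x : 'cV[R]_n | (a *m x) 0 0 <= b] !=set0 ->
  polyhedral [set x : 'cV[R]_n | (a *m x) 0 0 <= b].
Proof.
move=> h; have [a0|a_neq0] := eqVneq a 0; last first.
  by apply: closed_halfspace_polyhedral; exists a, b.
have [b_ge0|b_lt0] := leP 0 b.
  have -> : [set x : 'cV[R]_n | (a *m x) 0 0 <= b] = setT.
    by apply/seteqP; split=> // x _ /=; rewrite a0 mul0mx mxE.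
  exact: polyhedralT.
have E : [set x : 'cV[R]_n | (a *m x) 0 0 <= b] = set0.
  apply/seteqP; split=> // x /=.
  by rewrite a0 mul0mx mxE leNgt b_lt0.
by rewrite E in h *; case: h => [|[]//]; exact: polyhedral0.
Qed.

(** Only nonempty solution sets are covered: row by row, the infeasible
    zero rows are thereby ruled out. *)
Lemma polyhedral_system m (H : 'M[R]_(m, n)) (h : 'cV[R]_m) :
  [set x : 'cV[R]_n | forall i, (H *m x) i 0 <= h i 0] !=set0 ->
  polyhedral [set x : 'cV[R]_n | forall i, (H *m x) i 0 <= h i 0].
Proof.
move=> [x0 hx0].
have rowE i (x : 'cV[R]_n) : (H *m x) i 0 = (row i H *m x) 0 0.
  by rewrite -row_mul [RHS]mxE.
have -> : [set x : 'cV[R]_n | forall i, (H *m x) i 0 <= h i 0] =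
          \bigcap_i [set x | (row i H *m x) 0 0 <= h i 0].
  by apply/seteqP; split=> x xP i => [_|]; have := xP i; rewrite /= rowE //; apply.
apply: polyhedral_bigcap => i; apply: polyhedral_le; right.
by exists x0; rewrite /= -rowE.
Qed.

Lemma closed_halfspace_dim_gt0 S : closed_halfspace S -> (0 < n)%N.
Proof.
move=> [a [_ [a_neq0 _]]]; case: n a a_neq0 => // a.
by rewrite thinmx0 eqxx.
Qed.

(** Convexity is all that the reduction from a convex hull to its generators
    needs of a polyhedral set. *)
Lemma polyhedral_convex S : polyhedral S -> convex_set S.
Proof.
move=> [m [P [hP ->]]] x y t; rewrite !inE => Sx Sy i _.
have [a [b [_ Pi]]] := hP i.
have := Sx i I; have := Sy i I; rewrite Pi /= => ay ax.
rewrite conv_lmodE mulmxDr -!scalemxAr.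
rewrite [leLHS]mxE [X in X + _]mxE [X in _ + X]mxE.
have t_ge0 : 0 <= t%:num by [].
have t'_ge0 : 0 <= 1 - t%:num by rewrite subr_ge0.
have -> : b = t%:num * b + (1 - t%:num) * b by rewrite -mulrDl addrC subrK mul1r.
by apply: lerD; apply: ler_wpM2l.
Qed.

End PolyhedralSets.

(** * The robust predecessor operator *)

Section RobustPre.
Variables (R : realType) (n : nat).
Implicit Types (F : set 'M[R]_n) (X W S : set 'cV[R]_n).

Lemma robust_preP F W S x :
  robust_pre F W S x <->
  (forall A w, F A -> W w -> S (A *m x + w)).
Proof.
split=> [xS A w FA Ww|xS A FA _ [w Ww <-]]; last exact: xS.
by apply: (xS A FA); exists w.
Qed.

(** For fixed [x], [w] the successor [A *m x + w] is affine in [A], so the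
    matrices that keep it in a convex set form a convex set. *)
Lemma robust_pre_convex_hull F W S :
  convex_set S -> robust_pre (convex_hull F) W S = robust_pre F W S.
Proof.
move=> convS; apply/seteqP; split=> x /robust_preP xS; apply/robust_preP.
  by move=> A w FA; apply: xS; exact: sub_smallest FA.
move=> A w FA Ww.
apply: (smallest_sub (X := [set B | S (B *m x + w)])) FA => [|B FB]; last exact: xS.
move=> B C t; rewrite !inE /= => SB SC.
have := convS (B *m x + w) (C *m x + w) t; rewrite !inE => /(_ SB SC).
congr S; rewrite !conv_lmodE mulmxDl -!scalemxAl !scalerDr addrACA -scalerDl.
by rewrite [t%:num + _]addrC subrK scale1r.
Qed.

(** Bounding [a *m w] over [W] by its supremum tightens the half-space
    [a *m x <= b] and leaves a single linear inequality on [x]. *)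
Lemma polyhedral_robust_pre1 (A : 'M[R]_n) W S :
  W !=set0 -> bounded_set W -> closed_halfspace S ->
  polyhedral (robust_pre [set A] W S).
Proof.
move=> [w0 Ww0] bW hS; have n_gt0 := closed_halfspace_dim_gt0 hS.
have [a [b [_ Sab]]] := hS.
pose E := [set (a *m w) 0 0 | w in W].
have supE : has_sup E.
  split; first by exists ((a *m w0) 0 0), w0.
  have /pinfty_ex_gt0 [M _ WM] := bW.
  (* [M] bounds the sup norm on [W], hence every entry of [w]. *)
  exists (\sum_j `|a 0 j| * M) => _ [w Ww <-].
  rewrite mxE; apply: ler_sum => j _.
  rewrite (le_trans (ler_norm _))// normrM ler_wpM2l//.
  apply: le_trans (WM w Ww).
  rewrite /Num.norm /= mx_normrE.
  exact: (le_bigmax _ (fun ij => `|w ij.1 ij.2|) (j, ord0)).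
have -> : robust_pre [set A] W S =
          [set x | (a *m A *m x) 0 0 <= b - sup E].
  apply/seteqP; split=> x.
  - move/robust_preP => xS /=; rewrite lerBrDr addrC -lerBrDr.
    apply: ge_sup; first exact: supE.1.
    move=> _ [w Ww <-].
    have := xS A w erefl Ww.
    by rewrite Sab /= mulmxDr mxE mulmxA lerBrDr addrC.
  - move=> /= xE; apply/robust_preP => _ w -> Ww.
    rewrite Sab /= mulmxDr mxE mulmxA -lerBrDr (le_trans xE)// lerB//.
    by apply: (sup_upper_bound supE); exists w.
by apply: polyhedral_le; left.
Qed.

(** The operator commutes with the intersection defining [S] and with the one
    over the family, so only one matrix and one half-space matter at a time. *)
Lemma polyhedral_robust_pre_range s (Abar : 'I_s -> 'M[R]_n) W S :
  W !=set0 -> bounded_set W -> polyhedral S ->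
  polyhedral (robust_pre (range Abar) W S).
Proof.
move=> W0 bW [m [P [hP ->]]].
have -> : robust_pre (range Abar) W (\bigcap_i P i) =
          \bigcap_j \bigcap_i robust_pre [set Abar j] W (P i).
  apply/seteqP; split=> x.
    move/robust_preP => xP j _ i _; apply/robust_preP => _ w -> Ww.
    by apply: xP => //; exists j.
  move=> xP; apply/robust_preP => _ w [j _ <-] Ww i _.
  by have /robust_preP := xP j I i I; apply.
apply: polyhedral_bigcap => j; apply: polyhedral_bigcap => i.
exact: polyhedral_robust_pre1.
Qed.

End RobustPre.

(** * The sets [Y_seq] by backward recursion *)

Section BackwardRecursion.
Variables (R : realType) (n : nat).
Implicit Types (A : nat -> 'M[R]_n) (w : nat -> 'cV[R]_n).
Implicit Types (F : set 'M[R]_n) (X W : set 'cV[R]_n).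

Lemma transition_succ A k i :
  transition A k.+1 i.+1 = transition (A \o succn) k i.
Proof.
by rewrite /transition /index_iota subSS (iotaDl 1) -map_rev big_map.
Qed.

Lemma transition_0l A k :
  transition A k.+1 0 = transition (A \o succn) k 0 *m A 0%N.
Proof.
by rewrite -transition_succ /transition /index_iota /= rev_cons big_rcons /= subn1.
Qed.

(** The state reached at time [k] from [x] under the matrices [A] and the
    disturbances [w], written with the transition matrices of [Y_inter]. *)
Definition final_state A w k (x : 'cV[R]_n) : 'cV[R]_n :=
  transition A k 0 *m x + \sum_(i < k) transition A k i.+1 *m w i.

(** Performing the first step separately leaves a trajectory of length [k]
    driven by the shifted sequences. *)
Lemma final_stateS A w k x :
  final_state A w k.+1 x =
  final_state (A \o succn) (w \o succn) k (A 0%N *m x + w 0%N).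
Proof.
rewrite /final_state transition_0l mulmxDr mulmxA -addrA big_ord_recl.
rewrite transition_succ; congr (_ + (_ + _)).
by apply: eq_bigr => i _; rewrite transition_succ.
Qed.

(** A point of the Minkowski sum is a choice of one disturbance for each time,
    so membership quantifies over all pairs of sequences. *)
Lemma Y_interP F X W k x :
  Y_inter F X W k x <->
  (forall A w, (forall j, (j < k)%N -> F (A j)) ->
     (forall j, (j < k)%N -> W (w j)) -> X (final_state A w k x)).
Proof.
split=> [xY A w FA Ww|xX Psi [A FA PsiA] _ [_ [v vW <-] <-]].
  pose Psi (i : 'I_k.+1) := transition A k i.
  have /xY xPsi : transition_tuples F k Psi by exists A.
  apply: xPsi; exists (\sum_(i < k) transition A k i.+1 *m w i) => //.
  exists (fun i : 'I_k => transition A k i.+1 *m w i) => //= i.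
  by exists (w i); [exact: Ww|rewrite /Psi lift0].
have /choice[u uP] i : exists u, W u /\ Psi (lift ord0 i) *m u = v i.
  by have [u] := vW i; exists u.
pose w j := if insub j is Some i then u i else 0.
have := xX A w FA; rewrite /final_state PsiA /=.
rewrite (eq_bigr v) => [|i _]; last first.
  by rewrite /w valK -(uP i).2 PsiA lift0.
by apply=> j jk; rewrite /w insubT; exact: (uP _).1.
Qed.

Lemma Y_seqP F X W k x :
  Y_seq F X W k x <->
  (forall A w, (forall j, (j < k)%N -> F (A j)) ->
     (forall j, (j < k)%N -> W (w j)) -> X (final_state A w k x)).
Proof.
case: k => [|k]; last exact: Y_interP.
have E A w : final_state A w 0 x = x.
  by rewrite /final_state /transition big_nil mul1mx big_ord0 addr0.
split=> [Xx A w _ _|]; first by rewrite E.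
by move=> /(_ (fun=> 0) (fun=> 0)); rewrite E; apply.
Qed.

(** The universally quantified first pair of matrix and disturbance can be
    chosen independently of the remaining ones. *)
Lemma Y_seqS F X W k :
  Y_seq F X W k.+1 = robust_pre F W (Y_seq F X W k).
Proof.
apply/seteqP; split=> x.
  move/Y_seqP => xX; apply/robust_preP => B v FB Wv; apply/Y_seqP => A w FA Ww.
  (* Prepend the first step to the trajectory. *)
  pose A' j := if j is i.+1 then A i else B.
  pose w' j := if j is i.+1 then w i else v.
  have := xX A' w'; rewrite final_stateS; apply.
  - by case=> // j; exact: FA.
  - by case=> // j; exact: Ww.
move/robust_preP => xY; apply/Y_seqP => A w FA Ww; rewrite final_stateS.
have /Y_seqP := xY _ _ (FA 0%N isT) (Ww 0%N isT); apply.
- by move=> j jk; exact: FA.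
- by move=> j jk; exact: Ww.
Qed.

End BackwardRecursion.

(** * Polyhedrality and reduction to the vertices *)

Theorem corollary9 (R : realType) (n mX s : nat)
    (HX : 'M[R]_(mX, n)) (hX : 'cV[R]_mX) (X W : set 'cV[R]_n)
    (Abar : 'I_s -> 'M[R]_n) (F : set 'M[R]_n) (r : recursion)
    (X_def : X = [set x | forall i : 'I_mX, (HX *m x) i 0 <= hX i 0])
    (X_nonempty : X !=set0)
    (W_nonempty : W !=set0)
    (W_bounded : bounded_set W)
    (F_case : F = range Abar \/ F = convex_hull (range Abar)) :
  ((forall k : nat, polyhedral (X_seq r F X W k) /\ polyhedral (Y_seq F X W k))
   /\
   (forall M : set 'cV[R]_n, maximal_rpi F W X M ->
      (exists k : nat, M = X_seq r F X W k) -> polyhedral M))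
  /\
  (F = convex_hull (range Abar) ->
   (forall k : nat,
      Xbar_succ r F X W k =
        \bigcap_(A in F)
          mulmx A @^-1` pontryagin_diff (X_seq r F X W k) W
      /\
      Xbar_succ r F X W k =
        \bigcap_(i : 'I_s)
          mulmx (Abar i) @^-1` pontryagin_diff (X_seq r F X W k) W)
   /\
   (forall k : nat, (1 <= k)%N ->
      Y_seq F X W k = Y_inter F X W k /\
      Y_seq F X W k = Y_inter (range Abar) X W k)).
Proof.
have polyX : polyhedral X by rewrite X_def in X_nonempty *; exact: polyhedral_system.
have preE S : polyhedral S -> robust_pre F W S = robust_pre (range Abar) W S.
  move=> polyS; case: F_case => -> //.
  by apply: robust_pre_convex_hull; exact: polyhedral_convex.
have poly_pre S : polyhedral S -> polyhedral (robust_pre F W S).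
  by move=> polyS; rewrite preE//; exact: polyhedral_robust_pre_range.
have polyY k : polyhedral (Y_seq F X W k).
  by elim: k => [//|k IHk]; rewrite Y_seqS; exact: poly_pre.
have polyXk k : polyhedral (X_seq r F X W k).
  elim: k => [//|k IHk] /=.
  by case: r IHk => IHk; apply: polyhedralI => //; solve [exact: poly_pre|exact: (polyY k.+1)].
have Y_range k : Y_seq F X W k = Y_seq (range Abar) X W k.
  by elim: k => [//|k IHk]; rewrite !Y_seqS preE// IHk.
split; first by split=> [k|M _ [k ->]].
move=> _; split=> [k|[//|k] _]; last by split=> //; exact: Y_range.
by split=> //; rewrite /Xbar_succ preE// /robust_pre bigcap_image.
Qed.
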